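(* The ORBIT algorithm produces an $O(\varepsilon\log\kappa)$-competitive online solution. That is, there is an absolute constant $C>0$ such that for every $\kappa\ge 2$, every $\varepsilon\ge 1$, every family $G_1,\dots,G_\kappa$ of partitions with costs $\pi_1,\dots,\pi_\kappa\ge 1$, and every finite sequence $D$ of demands with $Q(d)\neq\emptyset$ for all $d\in D$, the vector $z=(z_1,\dots,z_\kappa)$ held by ORBIT after all demands of $D$ have been processed is a feasible solution of the primal program $\mathcal P$ and satisfies $$\sum_{i=1}^{\kappa}\pi_i z_i\ \le\ C\,\varepsilon\log\kappa\cdot \mathrm{OPT},$$ where $\mathrm{OPT}$ is the optimal (offline) value of $\mathcal P$.
   Context: Setting. A network infrastructure is a directed graph $G=(V,E)$ with link bandwidth capacities $C_{1,e}$. It is divided into $\kappa$ partitions $G_i=(V_i,E_i)$, $i=1,\dots,\kappa$, by solving a $(\kappa,\varepsilon)$ balanced partition problem (each $G_i$ has at most $\varepsilon |V|/\kappa$ nodes, and the capacity of the edges between distinct partitions is minimized). The cost $\pi_i$ is the sum of the bandwidth capacities of the edges in a minimum spanning tree of $G_i$. Standing assumptions: $\varepsilon\ge 1$ and $\pi_i\ge 1$ for all $i$. Demands $d$ of a finite set $D$ arrive one by one. When $d$ arrives, the set $Q(d)\subseteq\{1,\dots,\kappa\}$ of indices $i$ such that $G_i$ can provide all network functions required by $d$ is revealed. Demands with $Q(d)=\emptyset$ are rejected on arrival, so all demands in $D$ have $Q(d)\ne\emptyset$. The graph structure enters the programs and the updates below only through the numbers $\pi_i$ and the sets $Q(d)$.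 Primal program $\mathcal P$: minimize $\sum_{i=1}^{\kappa}\pi_i z_i$ subject to $\sum_{i\in Q(d)} z_i\ge 1$ for all $d\in D$, and $z_i\ge 0$ for $1\le i\le\kappa$. In the online version the constraints (one per demand) are revealed one by one as the demands arrive. ORBIT algorithm (the part determining $z$): initially $z_i=0$ for all $i$. When a demand $d$ arrives: while $\sum_{i\in Q(d)} z_i<1$, perform one iteration, which for every $i\in Q(d)$ replaces $$z_i\ \leftarrow\ z_i\Bigl(1+\frac{1}{\pi_i\varepsilon}\Bigr)+\frac{1}{\pi_i|Q(d)|}.$$ The $z_i$ are not reset between demands. The competitive ratio is the ratio between the cost of the online solution and that of the optimal offline solution. *)

(* Defs.v *)
From mathcomp Require Import all_boot all_order all_algebra.
From mathcomp Require Import all_classical all_reals all_analysis.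

Set Implicit Arguments.
Unset Strict Implicit.
Unset Printing Implicit Defensive.

Import Order.TTheory GRing.Theory Num.Theory.
Local Open Scope ring_scope.

(* The graph partitions G_0, ..., G_(k-1) are the indices 'I_k. The programs
   and the algorithm depend on them only through the spanning-tree costs
   cost i (written pi_i in the mathematics) and, for each demand d, the set Q d
   of the partitions able to serve d. *)

Definition primal_feasible (R : realType) (k : nat) (T : eqType)
    (Q : T -> {set 'I_k}) (D : seq T) (z : 'I_k -> R) : Prop :=
  (forall d, d \in D -> 1 <= \sum_(i in Q d) z i) /\ (forall i, 0 <= z i).

Definition primal_value (R : realType) (k : nat) (cost z : 'I_k -> R) : R :=
  \sum_(i < k) cost i * z i.

(* [inf] is a genuine infimum here when every Q d is nonempty and the costs are
   nonnegative: the all-ones vector is feasible and all values are >= 0. *)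
Definition primal_opt (R : realType) (k : nat) (T : eqType)
    (cost : 'I_k -> R) (Q : T -> {set 'I_k}) (D : seq T) : R :=
  inf [set primal_value cost z | z in primal_feasible Q D]%classic.

Definition orbit_iter (R : realType) (k : nat) (eps : R) (cost : 'I_k -> R)
    (q : {set 'I_k}) (z : 'I_k -> R) : 'I_k -> R :=
  fun i => if i \in q
           then z i * (1 + 1 / (cost i * eps)) + 1 / (cost i * #|q|%:R)
           else z i.

(* Big-step semantics of the while loop run on arrival of a demand d with
   Q d = q: [orbit_serve eps cost q z z'] holds when the loop started from z
   terminates in z'. *)
Inductive orbit_serve (R : realType) (k : nat) (eps : R) (cost : 'I_k -> R)
    (q : {set 'I_k}) : ('I_k -> R) -> ('I_k -> R) -> Prop :=
| orbit_serve_stop z of 1 <= \sum_(i in q) z i :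
    orbit_serve eps cost q z z
| orbit_serve_iter z z' of \sum_(i in q) z i < 1
    & orbit_serve eps cost q (orbit_iter eps cost q z) z' :
    orbit_serve eps cost q z z'.

Fixpoint orbit_from (R : realType) (k : nat) (T : eqType) (eps : R)
    (cost : 'I_k -> R) (Q : T -> {set 'I_k}) (D : seq T)
    (z z' : 'I_k -> R) : Prop :=
  match D with
  | [::] => z' = z
  | d :: D' => exists2 w, orbit_serve eps cost (Q d) z w
                        & orbit_from eps cost Q D' w z'
  end.

Definition orbit_output (R : realType) (k : nat) (T : eqType) (eps : R)
    (cost : 'I_k -> R) (Q : T -> {set 'I_k}) (D : seq T) (z : 'I_k -> R) : Prop :=
  orbit_from eps cost Q D (fun=> 0) z.

(* Main.v *)
(* Fix a feasible vector w. An iteration started while the entries of Q d sum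
   to less than 1 raises the primal value by at most 1 + 1/eps <= 2. It also
   multiplies 1 + k z_i / eps by at least 1 + 1/(pi_i eps) for each i in Q d, so
   the potential \sum_i 4 eps pi_i w_i ln (1 + k z_i / eps) grows by at least
   2 \sum_(i in Q d) w_i >= 2. Hence the value never exceeds the potential; as
   entries stay at most 3 and 1 + 3 k <= k^3, the potential is at most
   12 eps ln k times the value of w. *)

Require Import Defs.
From mathcomp Require Import all_boot all_order all_algebra.
From mathcomp Require Import all_classical all_reals all_analysis.
From mathcomp Require Import ring lra.

Set Implicit Arguments.
Unset Strict Implicit.
Unset Printing Implicit Defensive.

Import Order.TTheory GRing.Theory Num.Theory.
Local Open Scope ring_scope.

(** Since 1/(1 + x) = 1 - x/(1 + x), the tangent bound ln (1 + y) <= y at y = -x/(1 + x) gives ln (1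
    + x) >= x/(1 + x), and 1 + x <= 2. *)
Lemma ln1D_ge_half (R : realType) (x : R) : 0 <= x <= 1 -> x / 2 <= ln (1 + x).
Proof.
move=> /andP[x0 x1].
have x1_gt0 : 0 < 1 + x by lra.
have : ln (1 + (- (x / (1 + x)))) <= - (x / (1 + x)).
  by apply: le_ln1Dx; rewrite ltrN2 ltr_pdivrMr //; lra.
have -> : 1 + (- (x / (1 + x))) = (1 + x)^-1 by field; rewrite gt_eqF.
rewrite lnV ?posrE // lerN2; apply: le_trans.
by apply: ler_wpM2l => //; rewrite lef_pV2 ?posrE //; lra.
Qed.

Section Orbit.
Context (R : realType) (k : nat) (eps : R) (cost : 'I_k -> R).
Hypotheses (eps_ge1 : 1 <= eps) (cost_ge1 : forall i, 1 <= cost i).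

Implicit Types (q : {set 'I_k}) (z w : 'I_k -> R).

(** * Bounds on a single iteration *)

Let eps_gt0 : 0 < eps. Proof. exact: lt_le_trans eps_ge1. Qed.

Let cost_gt0 i : 0 < cost i. Proof. exact: lt_le_trans (cost_ge1 i). Qed.

Let card_gt0R q i : i \in q -> 0 < #|q|%:R :> R.
Proof. by move=> iq; rewrite ltr0n; apply/card_gt0P; exists i. Qed.

Let rate_bound i : 0 < 1 / (cost i * eps) <= 1.
Proof.
have ce_gt0 : 0 < cost i * eps by rewrite mulr_gt0.
by rewrite divr_gt0 //= ler_pdivrMr // mul1r mulr_ege1.
Qed.

Let increment_bound q i : i \in q ->
  0 < 1 / (cost i * #|q|%:R) <= 1.
Proof.
move=> iq; have q_gt0 := card_gt0R iq.
have cq_gt0 : 0 < cost i * #|q|%:R by rewrite mulr_gt0.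
rewrite divr_gt0 //= ler_pdivrMr // mul1r mulr_ege1 //.
by rewrite ler1n -(ltr0n R).
Qed.

Lemma orbit_iter_ge q z : (forall i, 0 <= z i) ->
  forall i, z i <= orbit_iter eps cost q z i.
Proof.
move=> z0 i; rewrite /orbit_iter; case: ifPn => // iq.
have /andP[r0 _] := rate_bound i; have /andP[c0 _] := increment_bound iq.
by have := z0 i; nra.
Qed.

Lemma orbit_iter_ge0 q z : (forall i, 0 <= z i) ->
  forall i, 0 <= orbit_iter eps cost q z i.
Proof. by move=> z0 i; exact: le_trans (orbit_iter_ge _ z0 _). Qed.

(** The loop guard forces each entry of [q] below 1; the factor is at most 2 and the increment at
    most 1, whence 1 * 2 + 1 = 3. *)
Lemma orbit_iter_le3 q z : (forall i, 0 <= z i <= 3) ->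
  \sum_(i in q) z i < 1 -> forall i, orbit_iter eps cost q z i <= 3.
Proof.
move=> z03 zq i; rewrite /orbit_iter.
case: ifPn => [iq|_]; last by case/andP: (z03 i).
have zi1 : z i < 1.
  apply: le_lt_trans zq; rewrite (bigD1 i) //= lerDl sumr_ge0 // => j _.
  by case/andP: (z03 j).
have /andP[z0 _] := z03 i.
have /andP[r0 r1] := rate_bound i; have /andP[_ c1] := increment_bound iq.
by nra.
Qed.

Lemma primal_value_orbit_iter q z : \sum_(i in q) z i < 1 ->
  primal_value cost (orbit_iter eps cost q z) <= primal_value cost z + 2.
Proof.
move=> zq; rewrite /primal_value.
have -> : \sum_i cost i * orbit_iter eps cost q z i =
    \sum_i cost i * z i + \sum_(i in q) (z i / eps + #|q|%:R^-1).
  rewrite [X in _ = _ + X]big_mkcond -big_split; apply: eq_bigr => i _ /=.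
  rewrite /orbit_iter; case: ifPn => iq; last by rewrite addr0.
  by field; rewrite !gt_eqF //= (card_gt0R iq).
rewrite lerD2l big_split /= -mulr_suml; apply: lerD.
  rewrite ler_pdivrMr // mul1r.
  exact: le_trans (ltW zq) eps_ge1.
rewrite sumr_const -[_ *+ _]mulr_natr.
(* The increments 1/|q| total 1, or 0 when [q] is empty. *)
have [->|q_neq0] := eqVneq #|q| 0%N; first by rewrite mulr0.
by rewrite mulVf // pnatr_eq0.
Qed.

(** * The logarithmic potential *)

Definition orbit_potential w z : R :=
  \sum_(i < k) 4 * eps * cost i * w i * ln (1 + k%:R * z i / eps).

(** With a = k z_i / eps and r = 1/(pi_i eps), the new argument is 1 + a (1 + r) + (k/|q|) r. As |q|
    <= k, this is at least (1 + a)(1 + r): the scaling by k lets the additive increment supply the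
    growth of the summand 1. Finally ln (1 + r) >= r/2. *)
Lemma ln_orbit_iter q z i : i \in q -> 0 <= z i ->
  ln (1 + k%:R * z i / eps) + 1 / (2 * eps * cost i) <=
  ln (1 + k%:R * orbit_iter eps cost q z i / eps).
Proof.
move=> iq zi0; have /andP[r0 r1] := rate_bound i.
have q_gt0 := card_gt0R iq.
have kz_ge0 : 0 <= k%:R * z i / eps by rewrite divr_ge0 ?mulr_ge0 // ltW.
have kz1_gt0 : 0 < 1 + k%:R * z i / eps by lra.
have r1_gt0 : 0 < 1 + 1 / (cost i * eps) by lra.
have qk : 1 <= k%:R / #|q|%:R :> R.
  by rewrite ler_pdivlMr // mul1r ler_nat -[leqRHS]card_ord max_card.
have -> : 1 / (2 * eps * cost i) = 1 / (cost i * eps) / 2.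
  by field; rewrite !gt_eqF.
apply: (@le_trans _ _ (ln ((1 + k%:R * z i / eps) * (1 + 1 / (cost i * eps))))).
  rewrite lnM ?posrE // lerD2l; apply: ln1D_ge_half.
  by rewrite ltW.
rewrite /orbit_iter iq.
have -> : 1 + k%:R * (z i * (1 + 1 / (cost i * eps)) + 1 / (cost i * #|q|%:R))
      / eps = 1 + k%:R * z i / eps * (1 + 1 / (cost i * eps)) +
    k%:R / #|q|%:R * (1 / (cost i * eps)).
  by field; rewrite !gt_eqF.
set r := 1 / (cost i * eps) in r0 r1 r1_gt0 *.
set a := k%:R * z i / eps in kz_ge0 kz1_gt0 *.
set b := k%:R / #|q|%:R in qk *.
by rewrite ler_ln ?posrE; nra.
Qed.

Lemma orbit_potential_iter q w z : (forall i, 0 <= w i) ->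
  1 <= \sum_(i in q) w i -> (forall i, 0 <= z i) ->
  orbit_potential w z + 2 <= orbit_potential w (orbit_iter eps cost q z).
Proof.
move=> w0 wq z0.
apply: (@le_trans _ _ (orbit_potential w z + \sum_(i in q) 2 * w i)).
  by rewrite lerD2l -mulr_sumr; lra.
rewrite /orbit_potential [X in _ + X <= _]big_mkcond -big_split /=.
apply: ler_sum => i _; have [iq|iq] := ifPn; last first.
  by rewrite /orbit_iter (negbTE iq) addr0.
(* The weight 4 eps pi_i w_i turns the logarithmic gain 1/(2 eps pi_i) into 2 w_i. *)
have -> : 2 * w i = 4 * eps * cost i * w i * (1 / (2 * eps * cost i)).
  by field; rewrite !gt_eqF.
rewrite -mulrDr ler_wpM2l ?ln_orbit_iter //.
by rewrite !mulr_ge0 // ltW.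
Qed.

Lemma orbit_potential_le w z : (2 <= k)%N -> (forall i, 0 <= w i) ->
  (forall i, 0 <= z i <= 3) ->
  orbit_potential w z <= 12 * eps * ln k%:R * primal_value cost w.
Proof.
move=> k2 w0 z03; rewrite /primal_value mulr_sumr; apply: ler_sum => i _.
have /andP[z0 z3] := z03 i.
have k2R : 2 <= k%:R :> R by rewrite ler_nat.
have kz_ge0 : 0 <= k%:R * z i / eps by rewrite divr_ge0 ?mulr_ge0 // ltW.
have kz_le : k%:R * z i / eps <= k%:R * 3.
  rewrite ler_pdivrMr // -mulrA ler_wpM2l //.
  by apply: le_trans z3 _; rewrite ler_peMr.
have lnk : ln (1 + k%:R * z i / eps) <= 3 * ln (k%:R : R).
  (* For k >= 2, 1 + 3 k <= 4 k <= k^3. *)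
  have k2_ge4 : 4 <= k%:R * k%:R :> R by nra.
  have k3_ge : 1 + k%:R * 3 <= k%:R ^+ 3 :> R by rewrite !exprS expr0; nra.
  rewrite [leRHS]mulr_natl -lnXn; last lra.
  by rewrite ler_ln ?posrE; lra.
have -> : 12 * eps * ln k%:R * (cost i * w i) =
  4 * eps * cost i * w i * (3 * ln k%:R) by ring.
by rewrite ler_wpM2l // !mulr_ge0 // ltW.
Qed.

(** * Loop invariants and feasibility *)

Lemma orbit_serve_inv (P : ('I_k -> R) -> Prop) q z z' :
  (forall x, P x -> \sum_(i in q) x i < 1 -> P (orbit_iter eps cost q x)) ->
  orbit_serve eps cost q z z' -> P z -> P z'.
Proof. by move=> Pq; elim=> // x x' xq _ IH Px; apply: IH; exact: Pq. Qed.

Lemma orbit_serve_sum q z z' :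
  orbit_serve eps cost q z z' -> 1 <= \sum_(i in q) z' i.
Proof. by elim. Qed.

Lemma orbit_from_inv (T : eqType) (Q : T -> {set 'I_k}) (D : seq T)
    (P : ('I_k -> R) -> Prop) z z' :
  (forall d x, d \in D -> P x -> \sum_(i in Q d) x i < 1 ->
     P (orbit_iter eps cost (Q d) x)) ->
  orbit_from eps cost Q D z z' -> P z -> P z'.
Proof.
elim: D z => [|d D IH] z PD /=; first by move=> ->.
case=> x zx xz' Pz; apply: (IH x) => // [e y eD|].
  by apply: PD; rewrite inE eD orbT.
apply: orbit_serve_inv zx Pz => y; apply: PD.
by rewrite inE eqxx.
Qed.

Lemma orbit_from_ge (T : eqType) (Q : T -> {set 'I_k}) (D : seq T) z z' :
  (forall i, 0 <= z i) -> orbit_from eps cost Q D z z' ->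
  forall i, z i <= z' i.
Proof.
move=> z0 zz' i.
have inv d x : d \in D -> (forall j, z j <= x j) ->
    \sum_(j in Q d) x j < 1 -> forall j, z j <= orbit_iter eps cost (Q d) x j.
  move=> _ zx _ j; apply: le_trans (zx j) _.
  by apply: orbit_iter_ge => l; exact: le_trans (zx l).
by move: i; apply: (orbit_from_inv inv zz').
Qed.

Lemma orbit_serve_ge0 q z z' : (forall i, 0 <= z i) ->
  orbit_serve eps cost q z z' -> forall i, 0 <= z' i.
Proof.
move=> z0 zz'.
apply: (orbit_serve_inv (P := fun x => forall i, 0 <= x i) _ zz' z0).
by move=> x x0 _; exact: orbit_iter_ge0.
Qed.

(** The loop for a demand exits only once its constraint holds, and later iterations never decrease
    an entry, so the constraint stays satisfied. *)
Lemma orbit_from_feasible (T : eqType) (Q : T -> {set 'I_k}) (D : seq T) z z' :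
  (forall i, 0 <= z i) -> orbit_from eps cost Q D z z' ->
  primal_feasible Q D z'.
Proof.
move=> z0 zz'; split; last first.
  by move=> i; apply: le_trans (orbit_from_ge z0 zz' i).
elim: D z z0 zz' => // d D IH z z0 [x zx xz'] e.
have x0 := orbit_serve_ge0 z0 zx.
rewrite inE => /orP[/eqP ->|]; last exact: IH xz' e.
apply: le_trans (orbit_serve_sum zx) _.
by apply: ler_sum => i _; exact: orbit_from_ge xz' i.
Qed.

(** * Termination *)

Lemma orbit_serve_terminates q z : q != finset.set0 -> (forall i, 0 <= z i) ->
  exists z', orbit_serve eps cost q z z'.
Proof.
move=> /set0Pn[i0 i0q].
(* The additive increment of one fixed [i0] in [q] does not depend on the current vector, so it
   bounds the progress of every iteration from below. *)
pose delta := 1 / (cost i0 * #|q|%:R).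
have delta_gt0 : 0 < delta by case/andP: (increment_bound i0q).
have progress x : (forall i, 0 <= x i) ->
    \sum_(i in q) x i + delta <= \sum_(i in q) orbit_iter eps cost q x i.
  move=> x0; rewrite (bigD1 i0) //= [leRHS](bigD1 i0) //= addrAC.
  apply: lerD; last by apply: ler_sum => i _; exact: orbit_iter_ge.
  rewrite /orbit_iter i0q lerD2r ler_peMr //.
  by have /andP[] := rate_bound i0; lra.
have [n n_delta] : exists n : nat, 1 <= n%:R * delta.
  exists (Num.truncn delta^-1).+1; rewrite -ler_pdivrMr // mul1r ltW //.
  exact: truncnS_gt.
(* Induction on a bound [n] for the iterations left: the deficit is at most [n * delta], and each
   iteration pays for one [delta]. *)
move=> z0; have : 1 - n%:R * delta <= \sum_(i in q) z i.
  by apply: (@le_trans _ _ 0); [lra|exact: sumr_ge0].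
elim: n z z0 {n_delta} => [|n IH] z z0 zn.
  by exists z; apply: orbit_serve_stop; rewrite mul0r subr0 in zn.
have [zq|zq] := lerP 1 (\sum_(i in q) z i).
  by exists z; apply: orbit_serve_stop.
have [||z' zz'] := IH (orbit_iter eps cost q z).
- exact: orbit_iter_ge0.
- by have := progress z z0; rewrite -natr1 in zn; lra.
- by exists z'; apply: orbit_serve_iter.
Qed.

Lemma orbit_from_terminates (T : eqType) (Q : T -> {set 'I_k}) (D : seq T) z :
  (forall d, d \in D -> Q d != finset.set0) -> (forall i, 0 <= z i) ->
  exists z', orbit_from eps cost Q D z z'.
Proof.
elim: D z => [|d D IH] z QD z0; first by exists z.
have [|x zx] := orbit_serve_terminates (QD d _) z0; first by rewrite inE eqxx.
have [|z' xz'] := IH x _ (orbit_serve_ge0 z0 zx).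
  by move=> e eD; apply: QD; rewrite inE eD orbT.
by exists z', x.
Qed.

Lemma orbit_output_value_le (T : eqType) (Q : T -> {set 'I_k}) (D : seq T) z w :
  (2 <= k)%N -> orbit_output eps cost Q D z -> primal_feasible Q D w ->
  primal_value cost z <= 12 * eps * ln k%:R * primal_value cost w.
Proof.
move=> k2 outz [wD w0].
(* The entry bounds are carried along because the final estimate of the potential needs them; at the
   zero vector both value and potential vanish. *)
pose P x := (forall i, 0 <= x i <= 3) /\
  primal_value cost x <= orbit_potential w x.
suff [z03 zw] : P z by exact: le_trans zw (orbit_potential_le k2 w0 z03).
apply: (orbit_from_inv _ outz) => [d x dD [x03 xw] xq|].
  have x0 i : 0 <= x i by case/andP: (x03 i).
  split=> [i|]; first by rewrite orbit_iter_ge0 ?orbit_iter_le3.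
  apply: le_trans (primal_value_orbit_iter xq) _.
  by apply: le_trans (orbit_potential_iter w0 (wD d dD) x0); rewrite lerD2r.
split=> [i|]; first by rewrite lexx ler0n.
rewrite /primal_value /orbit_potential !big1 // => i _.
  by rewrite mulr0 mul0r addr0 ln1 mulr0.
by rewrite mulr0.
Qed.

End Orbit.

Theorem proposition1 (R : realType) :
  exists2 C : R, 0 < C &
    forall (k : nat) (eps : R) (cost : 'I_k -> R) (T : eqType)
           (Q : T -> {set 'I_k}) (D : seq T),
      (2 <= k)%N ->
      1 <= eps ->
      (forall i, 1 <= cost i) ->
      (forall d, d \in D -> Q d != finset.set0) ->
      (exists z, orbit_output eps cost Q D z) /\
      (forall z, orbit_output eps cost Q D z ->
         primal_feasible Q D z /\
         primal_value cost z <= C * eps * ln k%:R * primal_opt cost Q D).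
Proof.
(* 12 is the weight 4 of the potential times the exponent 3 in k^3. *)
exists 12 => // k eps cost T Q D k2 eps1 cost1 QD; split.
  exact: orbit_from_terminates.
move=> z outz; have zfeas : primal_feasible Q D z.
  exact: orbit_from_feasible outz.
split=> //.
have c_gt0 : 0 < 12 * eps * ln k%:R.
  by rewrite !mulr_gt0 ?ln_gt0 ?ltr1n // (lt_le_trans _ eps1).
(* Dividing by the positive factor reduces the claim to a lower bound for all feasible values; the
   set is nonempty since it contains the value of [z] itself. *)
rewrite mulrC -ler_pdivrMr //; apply: lb_le_inf.
  by exists (primal_value cost z), z.
move=> _ [w wfeas <-]; rewrite ler_pdivrMr // mulrC.
exact: orbit_output_value_le outz wfeas.
Qed.
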